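(* Let $\lambda$ be a nonzero real number and $r$ a positive integer. For every integer $n\ge 0$ (and every real $x$), $$\sum_{k=0}^{n}S_{J,\lambda}^{(2)}(n,k)\,C_{k}^{(r)}(x)=\sum_{k=0}^{n}\binom{n}{k}\sum_{l=0}^{k}\mathcal{E}_{l,\lambda}^{(r)}\,S_{2,\lambda}(k,l)\,B_{n-k,\lambda}(x).$$
   Context: All generating functions are formal power series in $t$ with real coefficients. For $x\in\mathbb{R}$: $(x)_0=1$, $(x)_n=x(x-1)\cdots(x-n+1)$ for $n\ge1$; $(x)_{0,\lambda}=1$, $(x)_{n,\lambda}=x(x-\lambda)\cdots(x-(n-1)\lambda)$ for $n\ge 1$. The degenerate exponential is $e_\lambda^x(t)=(1+\lambda t)^{x/\lambda}=\sum_{n\ge0}(x)_{n,\lambda}\frac{t^n}{n!}$, $e_\lambda(t)=e_\lambda^1(t)$ (and $e_\lambda^{-1}(t)$ is the case $x=-1$). The degenerate Stirling numbers of the second kind $S_{2,\lambda}(n,l)$ are defined by $(x)_{n,\lambda}=\sum_{l=0}^n S_{2,\lambda}(n,l)(x)_{l}$ (polynomial identity in $x$, $n\ge0$). The Jindalrae-Stirling numbers of the second kind are defined, for $k\ge0$, by $\frac{1}{k!}\left(e_\lambda(e_\lambda(t)-1)-1\right)^k=\sum_{n\ge k}S_{J,\lambda}^{(2)}(n,k)\frac{t^n}{n!}$. The degenerate Bell polynomials are defined by $e_\lambda^x(e_\lambda(t)-1)=\sum_{n\ge0}B_{n,\lambda}(x)\frac{t^n}{n!}$. The type 2 degenerate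 Euler polynomials of order $r$ are defined by $\left(\frac{2}{e_\lambda(t)+e_\lambda^{-1}(t)}\right)^r e_\lambda^x(t)=\sum_{n\ge0}\mathcal{E}_{n,\lambda}^{(r)}(x)\frac{t^n}{n!}$, and $\mathcal{E}_{n,\lambda}^{(r)}=\mathcal{E}_{n,\lambda}^{(r)}(0)$. The type 2 Changhee polynomials of order $r$ are defined by $\left(\frac{2}{(1+t)+(1+t)^{-1}}\right)^r(1+t)^x=\sum_{n\ge0}C_n^{(r)}(x)\frac{t^n}{n!}$. *)

(* Defs.v *)
From HB Require Import structures.
From mathcomp Require Import all_boot all_order all_algebra.
From mathcomp Require Import ring boolp reals.

Set Implicit Arguments.
Unset Strict Implicit.
Unset Printing Implicit Defensive.

Import Order.TTheory GRing.Theory Num.Theory.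
Local Open Scope ring_scope.

(* f n is the coefficient of t^n in f *)
Record fps (R : Type) := FPS { coefs :> nat -> R }.

Lemma fpsP (R : Type) (f g : fps R) : f = g <-> (forall n, f n = g n).
Proof.
split=> [-> //|]; case: f g => [f] [g] /= fg; congr FPS.
exact: funext.
Qed.

HB.instance Definition _ (R : Type) := gen_eqMixin (fps R).
HB.instance Definition _ (R : Type) := gen_choiceMixin (fps R).

Section FpsLmodule.
Variable R : fieldType.
Implicit Types f g h : fps R.

Let zero : fps R := FPS (fun=> 0).
Let add f g : fps R := FPS (fun n => f n + g n).
Let opp f : fps R := FPS (fun n => - f n).
Let scale (c : R) f : fps R := FPS (fun n => c * f n).

Fact fps_addA : associative add.
Proof. by move=> f g h; apply/fpsP => n /=; rewrite addrA. Qed.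
Fact fps_addC : commutative add.
Proof. by move=> f g; apply/fpsP => n /=; rewrite addrC. Qed.
Fact fps_add0 : left_id zero add.
Proof. by move=> f; apply/fpsP => n /=; rewrite add0r. Qed.
Fact fps_addN : left_inverse zero opp add.
Proof. by move=> f; apply/fpsP => n /=; rewrite addNr. Qed.

HB.instance Definition _ :=
  GRing.isZmodule.Build (fps R) fps_addA fps_addC fps_add0 fps_addN.

Fact fps_scaleA a b f : scale a (scale b f) = scale (a * b) f.
Proof. by apply/fpsP => n /=; rewrite mulrA. Qed.
Fact fps_scale1 : left_id 1 scale.
Proof. by move=> f; apply/fpsP => n /=; rewrite mul1r. Qed.
Fact fps_scaleDr : right_distributive scale +%R.
Proof. by move=> c f g; apply/fpsP => n /=; rewrite mulrDr. Qed.
Fact fps_scaleDl f : {morph scale^~ f : a b / a + b}.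
Proof. by move=> a b; apply/fpsP => n /=; rewrite mulrDl. Qed.

HB.instance Definition _ := GRing.Zmodule_isLmodule.Build R (fps R)
  fps_scaleA fps_scale1 fps_scaleDr fps_scaleDl.

Lemma fps_coef0 n : (0 : fps R) n = 0. Proof. by []. Qed.
Lemma fps_coefD f g n : (f + g) n = f n + g n. Proof. by []. Qed.
Lemma fps_coefN f n : (- f) n = - f n. Proof. by []. Qed.
Lemma fps_coefB f g n : (f - g) n = f n - g n. Proof. by []. Qed.
Lemma fps_coefZ c f n : (c *: f) n = c * f n. Proof. by []. Qed.
Lemma fps_coef_sum (I : Type) (r : seq I) (P : pred I) (F : I -> fps R) n :
  (\sum_(i <- r | P i) F i) n = \sum_(i <- r | P i) F i n.
Proof. by elim/big_rec2: _ => // i _ f _ <-. Qed.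

End FpsLmodule.

Section FpsRing.
Variable R : fieldType.
Implicit Types f g h : fps R.

Let one : fps R := FPS (fun n => (n == 0%N)%:R).
Let mul f g : fps R := FPS (fun n => \sum_(i < n.+1) f i * g (n - i)%N).
Let trunc m f : {poly R} := \poly_(i < m) f i.

Let coef_mul_trunc m f g n : (n < m)%N ->
  (mul f g) n = (trunc m f * trunc m g)`_n.
Proof.
move=> nm; rewrite coefM; apply: eq_bigr => i _; rewrite !coef_poly.
have im : (i <= n)%N by rewrite -ltnS.
by rewrite (leq_ltn_trans im nm) (leq_ltn_trans (leq_subr i n) nm).
Qed.

Fact fps_mulC : commutative mul.
Proof.
by move=> f g; apply/fpsP => n; rewrite !(coef_mul_trunc _ _ (ltnSn n)) mulrC.
Qed.

Fact fps_mulA : associative mul.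
Proof.
have mulE f g h n : mul (mul f g) h n =
    ((trunc n.+1 f * trunc n.+1 g) * trunc n.+1 h)`_n.
  rewrite coefM; apply: eq_bigr => i _.
  by rewrite (coef_mul_trunc f g (ltn_ord i)) coef_poly ltnS leq_subr.
move=> f g h; apply/fpsP => n.
by rewrite fps_mulC !mulE mulrC mulrA.
Qed.

Fact fps_mul1 : left_id one mul.
Proof.
move=> f; apply/fpsP => n /=; rewrite big_ord_recl /= mul1r subn0 big1 ?addr0 //.
by move=> i _; rewrite mul0r.
Qed.

Fact fps_mulDl : left_distributive mul +%R.
Proof.
move=> f g h; apply/fpsP => n /=; rewrite -big_split /=.
by apply: eq_bigr => i _; rewrite mulrDl.
Qed.

Fact fps_one_neq0 : one != 0.
Proof. by apply/eqP => /fpsP /(_ 0%N) /eqP; rewrite oner_eq0. Qed.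

HB.instance Definition _ := GRing.Zmodule_isComNzRing.Build (fps R)
  fps_mulA fps_mulC fps_mul1 fps_mulDl fps_one_neq0.

Lemma fps_coef1 n : (1 : fps R) n = (n == 0%N)%:R. Proof. by []. Qed.
Lemma fps_coefM f g n : (f * g) n = \sum_(i < n.+1) f i * g (n - i)%N.
Proof. by []. Qed.

Lemma fps_coef0M f g : (f * g) 0%N = f 0%N * g 0%N.
Proof. by rewrite fps_coefM big_ord1. Qed.

Lemma fps_coefX_lt f k n : f 0%N = 0 -> (n < k)%N -> (f ^+ k) n = 0.
Proof.
move=> f0; elim: k n => // k IH n nk; rewrite exprS fps_coefM.
apply: big1 => -[[|i] ilt] _ /=; first by rewrite f0 mul0r.
rewrite IH ?mulr0 //; apply: leq_trans (_ : n <= k)%N => //.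
by rewrite ltn_subrL /= (leq_ltn_trans (leq0n i)).
Qed.

(* geometric series: f^-1 = f_0^-1 * \sum_k (1 - f / f_0)^k; powers with k > n
   do not contribute to the coefficient of t^n *)
Definition fps_inv f : fps R :=
  if f 0%N == 0 then f
  else FPS (fun n =>
    (f 0%N)^-1 * \sum_(k < n.+1) ((1 - (f 0%N)^-1 *: f) ^+ k) n).

Fact fps_mulV : {in [pred f : fps R | f 0%N != 0], left_inverse 1 fps_inv *%R}.
Proof.
move=> f; rewrite inE => f0; apply/fpsP => n; rewrite /fps_inv (negbTE f0).
set c := (f 0%N)^-1; set h := 1 - c *: f.
have h0 : h 0%N = 0 by rewrite /h fps_coefB fps_coefZ mulVf ?subrr.
have fE : c *: f = 1 - h by rewrite /h opprB addrC subrK.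
pose s := \sum_(k < n.+1) h ^+ k.
have sE i : (i <= n)%N -> \sum_(k < i.+1) (h ^+ k) i = s i.
  move=> ile; rewrite fps_coef_sum (big_ord_widen n.+1 (fun k => (h ^+ k) i)) //.
  rewrite big_mkcond; apply: eq_bigr => k _; case: ltnP => // ik.
  by rewrite fps_coefX_lt.
rewrite fps_coefM (eq_bigr (fun i : 'I_n.+1 => s i * (c *: f) (n - i)%N)).
  rewrite -fps_coefM mulrC fE -[1 - h]opprB mulNr -subrX1 opprB.
  rewrite fps_coefB fps_coefX_lt ?subr0 //.
move=> i _; rewrite fps_coefZ mulrA -[s i]sE -1?ltnS //.
by rewrite [_ * c]mulrC.
Qed.

Fact fps_unitP f g : g * f = 1 -> [pred f : fps R | f 0%N != 0] f.
Proof.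
move=> /fpsP /(_ 0%N); rewrite fps_coef0M fps_coef1 /= => gf.
by apply/eqP => f0; move/eqP: gf; rewrite f0 mulr0 eq_sym oner_eq0.
Qed.

Fact fps_inv_out : {in [predC [pred f : fps R | f 0%N != 0]], fps_inv =1 id}.
Proof. by move=> f; rewrite inE negbK /fps_inv => ->. Qed.

HB.instance Definition _ := GRing.ComNzRing_hasMulInverse.Build (fps R)
  fps_mulV fps_unitP fps_inv_out.

Lemma fps_unitE f : (f \is a GRing.unit) = (f 0%N != 0).
Proof. by []. Qed.

(* only meaningful when g has zero constant term *)
Definition fps_comp f g : fps R :=
  FPS (fun n => \sum_(k < n.+1) f k * (g ^+ k) n).

Definition fpsX : fps R := FPS (fun n => (n == 1%N)%:R).

(* egf_num f n is the a_n of f = \sum_n a_n t^n / n! *)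
Definition egf_num f n : R := n`!%:R * f n.

End FpsRing.

Arguments fpsX {R}.

Section Numbers.
Variable R : realType.
Implicit Types (lambda x : R) (n k l r : nat).

(* (x)_n *)
Definition ffall x n : R := \prod_(i < n) (x - i%:R).

(* (x)_{n, lambda} *)
Definition dfall lambda x n : R := \prod_(i < n) (x - i%:R * lambda).

(* (1 + t)^x *)
Definition binomial_fps x : fps R := FPS (fun n => ffall x n / n`!%:R).

(* e_lambda^x(t) *)
Definition dexp lambda x : fps R := FPS (fun n => dfall lambda x n / n`!%:R).

Lemma dexpE lambda x : lambda != 0 ->
  dexp lambda x = fps_comp (binomial_fps (x / lambda)) (lambda *: fpsX).
Proof.
move=> l0; have XnE k n : ((lambda *: fpsX) ^+ k) n = lambda ^+ k * (n == k)%:R.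
  elim: k n => [|k IH] n; first by rewrite expr0 mul1r.
  rewrite exprS fps_coefM; case: n => [|n].
    by rewrite big_ord1 fps_coefZ /= !mulr0 mul0r.
  rewrite big_ord_recl big_ord_recl big1 => [|i _]; last first.
    by rewrite fps_coefZ /= mulr0 mul0r.
  by rewrite !fps_coefZ /= mulr0 mul0r add0r addr0 mulr1 subSS subn0 IH mulrA -exprS.
apply/fpsP => n /=; rewrite (bigD1 ord_max) //= big1 => [|i /eqP ni].
  rewrite addr0 XnE eqxx mulr1 mulrAC; congr (_ / _).
  rewrite -[in lambda ^+ n](card_ord n) -prodr_const -big_split /=.
  by apply: eq_bigr => i _; rewrite mulrBl divfK.
rewrite XnE; case: eqP => [e|]; last by rewrite !mulr0.
by case: ni; apply: val_inj.
Qed.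

Lemma dstirling2_exists lambda : exists S : nat -> nat -> R,
  forall n x, dfall lambda x n = \sum_(l < n.+1) S n l * ffall x l.
Proof.
pose F := fix F n l : R := match n, l with
  | 0%N, 0%N => 1
  | 0%N, _.+1 => 0
  | m.+1, 0%N => - (m%:R * lambda) * F m 0%N
  | m.+1, j.+1 => F m j + (j.+1%:R - m%:R * lambda) * F m j.+1
  end.
have F0 n l : (n < l)%N -> F n l = 0.
  elim: n l => [|n IH] [|l] //= nl; rewrite !IH ?mulr0 ?addr0 //.
  exact: ltnW.
exists F; elim=> [|n IH] x.
  by rewrite /dfall big_ord0 big_ord1 /ffall big_ord0 mulr1.
have -> : dfall lambda x n.+1 = dfall lambda x n * (x - n%:R * lambda).
  by rewrite /dfall big_ord_recr.
have fS l : ffall x l.+1 = ffall x l * (x - l%:R) by rewrite /ffall big_ord_recr.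
have FS m j : F m.+1 j.+1 = F m j + (j.+1%:R - m%:R * lambda) * F m j.+1 by [].
have FS0 m : F m.+1 0%N = (0%:R - m%:R * lambda) * F m 0%N by rewrite sub0r.
move: F F0 FS FS0 IH => F F0 FS FS0 IH.
rewrite IH [RHS]big_ord_recl FS0.
rewrite [X in _ = _ + X](eq_bigr (fun l : 'I_n.+1 => F n l * ffall x l.+1 +
    (l.+1%:R - n%:R * lambda) * F n l.+1 * ffall x l.+1)); last first.
  by move=> l _; rewrite lift0 FS mulrDl.
rewrite big_split /= addrCA.
pose G l := (l%:R - n%:R * lambda) * F n l * ffall x l.
rewrite [X in _ = _ + X](_ : _ = \sum_(l < n.+2) G l); last by rewrite [RHS]big_ord_recl.
rewrite [X in _ = _ + X]big_ord_recr /= {2}/G F0 // mulr0 mul0r addr0 -big_split /=.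
by rewrite mulr_suml; apply: eq_bigr => l _; rewrite fS /G; ring.
Qed.

Lemma dstirling2_unique lambda (S S' : nat -> nat -> R) :
  (forall n x, dfall lambda x n = \sum_(l < n.+1) S n l * ffall x l) ->
  (forall n x, dfall lambda x n = \sum_(l < n.+1) S' n l * ffall x l) ->
  forall n l, (l <= n)%N -> S n l = S' n l.
Proof.
move=> HS HS' n l; elim/ltn_ind: l => l IH ln.
have := HS' n l%:R; rewrite HS (bigD1 (Ordinal (ln : (l < n.+1)%N))) //=.
rewrite [RHS](bigD1 (Ordinal (ln : (l < n.+1)%N))) //=.
rewrite (eq_bigr (fun i : 'I_n.+1 => S' n i * ffall l%:R i)); last first.
  move=> i; rewrite -val_eqE /= neq_ltn => /orP[il|li].
    by rewrite IH // -ltnS.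
  have -> : ffall l%:R i = 0; last by rewrite !mulr0.
  by rewrite /ffall (bigD1 (Ordinal li)) //= subrr mul0r.
move=> /addIr /mulIf; apply; apply/prodf_neq0 => i _.
by rewrite subr_eq0 eqr_nat gtn_eqF.
Qed.

(* dstirling2 lambda n l is only constrained for l <= n, as in the defining identity *)
Definition dstirling2 lambda : nat -> nat -> R :=
  sval (cid (dstirling2_exists lambda)).

(* Jindalrae-Stirling numbers of the second kind *)
Definition jstirling2 lambda n k : R :=
  egf_num (k`!%:R^-1 *:
    (fps_comp (dexp lambda 1) (dexp lambda 1 - 1) - 1) ^+ k) n.

Definition dbell lambda x n : R :=
  egf_num (fps_comp (dexp lambda x) (dexp lambda 1 - 1)) n.

(* e_lambda^{-1}(t) is dexp at x = -1 *)
Definition deuler2 lambda r x n : R :=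
  egf_num ((2%:R / (dexp lambda 1 + dexp lambda (-1))) ^+ r * dexp lambda x) n.

(* (1 + t)^-1 is the ring inverse, (1 + t)^x the binomial series *)
Definition changhee2 r x n : R :=
  egf_num ((2%:R / ((1 + fpsX) + (1 + fpsX)^-1)) ^+ r * binomial_fps x) n.

End Numbers.

(* Main.v *)
(* Write u = e_lambda(t) - 1.  The series F = (1 + u)^x satisfies
   (1 + lambda t) F' = x F and F(0) = 1, which characterises e_lambda^x(t).
   Hence (1 + t)^x composed with u is e_lambda^x(t); reading off coefficients as
   polynomials in x gives u^l / l! = sum_k S_{2,lambda}(k, l) t^k / k!.
   Substituting u in the generating function of the Changhee polynomials thus
   gives (2 / (e_lambda(t) + e_lambda^{-1}(t)))^r e_lambda^x(t), and substituting
   u once more turns the first factor into the generating function of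
   sum_l E_l S_{2,lambda}(k, l) and the second into that of the degenerate Bell
   polynomials. *)
Require Import Defs.
From mathcomp Require Import all_boot all_order all_algebra.
From mathcomp Require Import ring boolp reals.

Import GRing.Theory Num.Theory.
Local Open Scope ring_scope.

(** * Substitution into a formal power series *)

Section Composition.
Local Set Implicit Arguments.
Local Unset Strict Implicit.
Context {R : fieldType}.
Implicit Types (f g h : fps R) (c : R).

(** The quotient (f - f(0)) / t, on which the inductions on the degree recurse. *)
Definition fps_tail f : fps R := FPS (fun n => f n.+1).

Definition fps_deriv f : fps R := FPS (fun n => n.+1%:R * f n.+1).

Lemma fps_scalerAl c f g : c *: (f * g) = c *: f * g.
Proof.
apply/fpsP => n; rewrite fps_coefZ !fps_coefM mulr_sumr.
by apply: eq_bigr => i _; rewrite fps_coefZ mulrA.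
Qed.

Lemma fps_coefXM f n : (fpsX * f) n = if n is m.+1 then f m else 0.
Proof.
rewrite fps_coefM; case: n => [|n]; first by rewrite big_ord1 mul0r.
rewrite big_ord_recl big_ord_recl big1 => [|i _]; last by rewrite /= mul0r.
by rewrite /= mul0r mul1r add0r addr0 subSS subn0.
Qed.

Lemma fps_eq_tail f : f = f 0%N *: (1 : fps R) + fpsX * fps_tail f.
Proof.
apply/fpsP => n; rewrite fps_coefD fps_coefZ fps_coef1 fps_coefXM.
by case: n => [|n]; rewrite ?mulr1 ?addr0 // mulr0 add0r.
Qed.

(** A factor without constant term raises the degree, so the coefficient at n only sees coefficients
    below n of the other factor. This closes the strong inductions below. *)
Lemma eq_fps_coefM g f h n : g 0%N = 0 ->
  (forall i, (i < n)%N -> f i = h i) -> (g * f) n = (g * h) n.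
Proof.
move=> g0 fh; rewrite !fps_coefM; apply: eq_bigr => -[[|i] lti] _ /=.
  by rewrite g0 !mul0r.
by rewrite fh // ltn_subrL; case: n lti {fh}.
Qed.

Lemma fps_compD f h g : fps_comp (f + h) g = fps_comp f g + fps_comp h g.
Proof.
apply/fpsP => n; rewrite fps_coefD -big_split /=; apply: eq_bigr => i _.
by rewrite mulrDl.
Qed.

Lemma fps_compZ c f g : fps_comp (c *: f) g = c *: fps_comp f g.
Proof.
apply/fpsP => n; rewrite fps_coefZ /= mulr_sumr.
by apply: eq_bigr => i _; rewrite mulrA.
Qed.

Lemma fps_comp1 g : fps_comp 1 g = 1.
Proof.
apply/fpsP => n /=; rewrite big_ord_recl mul1r big1 ?addr0 //.
by move=> i _; rewrite mul0r.
Qed.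

Lemma fps_compN f g : fps_comp (- f) g = - fps_comp f g.
Proof. by rewrite -scaleN1r fps_compZ scaleN1r. Qed.

Lemma fps_comp_nat m g : fps_comp m%:R g = m%:R.
Proof.
elim: m => [|m IH]; last by rewrite !mulrS fps_compD fps_comp1 IH.
by apply/fpsP => n /=; rewrite big1 // => i _; rewrite mul0r.
Qed.

Lemma fps_comp_coef0 f g : (fps_comp f g) 0%N = f 0%N.
Proof. by rewrite /= big_ord1 mulr1. Qed.

Section ZeroConstantTerm.
Context (g : fps R) (g0 : g 0%N = 0).

(** For k > n the power g^k has no term in t^n, so one bound m can serve all coefficients below
    it. *)
Lemma fps_coef_comp f m n : (n < m)%N ->
  (fps_comp f g) n = \sum_(k < m) f k * (g ^+ k) n.
Proof.
move=> nm; rewrite /= (big_ord_widen m (fun k => f k * (g ^+ k) n)) //.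
rewrite big_mkcond; apply: eq_bigr => k _; case: ltnP => // nk.
by rewrite fps_coefX_lt ?mulr0.
Qed.

Lemma fps_comp_tail f :
  fps_comp f g = f 0%N *: (1 : fps R) + g * fps_comp (fps_tail f) g.
Proof.
apply/fpsP => n; rewrite fps_coefD fps_coefZ.
rewrite (@fps_coef_comp f n.+2) // big_ord_recl; congr (_ + _).
rewrite (@eq_fps_coefM _ _ (\sum_(k < n.+1) f k.+1 *: g ^+ k)) //.
  rewrite mulr_sumr fps_coef_sum; apply: eq_bigr => k _.
  by rewrite lift0 [g * _]mulrC -fps_scalerAl fps_coefZ exprSr.
move=> i lti; rewrite (@fps_coef_comp _ n.+1) ?fps_coef_sum //.
exact: ltnW.
Qed.

Lemma fps_compX : fps_comp fpsX g = g.
Proof.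
by rewrite fps_comp_tail scale0r add0r (_ : fps_tail _ = 1) ?fps_comp1 ?mulr1.
Qed.

(** Strong induction on the degree, for all f at once: f h = f(0) h + t (tail f) h, and substitution
    turns t into g, which lowers the degree needed of (tail f) h. *)
Lemma fps_compM f h : fps_comp (f * h) g = fps_comp f g * fps_comp h g.
Proof.
apply/fpsP => n; elim/ltn_ind: n f => n IH f.
have -> : f * h = f 0%N *: h + fpsX * (fps_tail f * h).
  by rewrite [in LHS](fps_eq_tail f) mulrDl -fps_scalerAl mul1r mulrA.
have tailXM p : fps_tail (fpsX * p) = p.
  by apply/fpsP => i; apply: fps_coefXM.
rewrite fps_compD fps_compZ (fps_comp_tail (fpsX * _)) tailXM.
rewrite fps_coefXM scale0r add0r (fps_comp_tail f) mulrDl -fps_scalerAl mul1r.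
rewrite !fps_coefD -mulrA; congr (_ + _).
by apply: eq_fps_coefM => // i ltin; apply: IH.
Qed.

Lemma fps_compXn f k : fps_comp (f ^+ k) g = fps_comp f g ^+ k.
Proof. by elim: k => [|k IH]; rewrite ?fps_comp1 // !exprS fps_compM IH. Qed.

Lemma fps_compV f : f 0%N != 0 -> fps_comp f^-1 g = (fps_comp f g)^-1.
Proof.
move=> f0; by apply/esym/mulr1_eq; rewrite -fps_compM divrr ?fps_comp1.
Qed.

End ZeroConstantTerm.

Lemma fps_compA f g h : g 0%N = 0 -> h 0%N = 0 ->
  fps_comp (fps_comp f g) h = fps_comp f (fps_comp g h).
Proof.
move=> g0 h0; apply/fpsP => n.
(* Every inner sum is extended to the same range so that the two sums can be exchanged; summing over
   k first then gives g^j composed with h. *)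
rewrite [LHS](eq_bigr (fun k : 'I_n.+1 =>
    \sum_(j < n.+1) f j * ((g ^+ j) k * (h ^+ k) n))) => [|k _].
  rewrite exchange_big; apply: eq_bigr => j _.
  by rewrite -mulr_sumr -fps_compXn.
rewrite (@fps_coef_comp _ g0 _ n.+1) // mulr_suml.
by apply: eq_bigr => j _; rewrite mulrA.
Qed.

(** * The formal derivative and the chain rule *)

Lemma fps_derivD f g : fps_deriv (f + g) = fps_deriv f + fps_deriv g.
Proof. by apply/fpsP => n; rewrite fps_coefD /= mulrDr. Qed.

Lemma fps_derivZ c f : fps_deriv (c *: f) = c *: fps_deriv f.
Proof. by apply/fpsP => n; rewrite fps_coefZ /= mulrCA. Qed.

Lemma fps_deriv1 : fps_deriv 1 = 0 :> fps R.
Proof. by apply/fpsP => n; rewrite /= mulr0. Qed.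

Lemma fps_derivM f g : fps_deriv (f * g) = fps_deriv f * g + f * fps_deriv g.
Proof.
apply/fpsP => n; rewrite fps_coefD /= mulr_sumr.
rewrite (eq_bigr (fun i : 'I_n.+2 => i%:R * f i * g (n.+1 - i)%N +
    f i * ((n.+1 - i)%:R * g (n.+1 - i)%N))) => [|i _]; last first.
  have ilen : (i <= n.+1)%N by rewrite -ltnS.
  by rewrite natrB //; ring.
rewrite big_split /=; congr (_ + _).
  by rewrite big_ord_recl !mul0r add0r.
rewrite big_ord_recr /= subnn mul0r mulr0 addr0.
by apply: eq_bigr => i _; rewrite subSn // -ltnS.
Qed.

Lemma fps_deriv_comp f g : g 0%N = 0 ->
  fps_deriv (fps_comp f g) = fps_comp (fps_deriv f) g * fps_deriv g.
Proof.
move=> g0; apply/fpsP => n; elim/ltn_ind: n f => n IH f.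
(* This is the product rule for f = f(0) + t (tail f); the induction hypothesis is applied to tail
   f. *)
have -> : fps_deriv f = fps_tail f + fpsX * fps_deriv (fps_tail f).
  apply/fpsP => -[|m]; rewrite fps_coefD fps_coefXM /= ?mul1r ?addr0 //.
  by rewrite [in LHS]mulrS mulrDl mul1r.
rewrite fps_compD fps_compM // fps_compX // mulrDl -mulrA fps_coefD.
rewrite fps_comp_tail // fps_derivD fps_derivZ fps_deriv1 scaler0 add0r.
rewrite fps_derivM fps_coefD mulrC; congr (_ + _).
by apply: eq_fps_coefM => // i ltin; apply: IH.
Qed.

End Composition.

(** * Degenerate exponentials, their differential equation and their substitutions *)

Section DegenerateExponential.
Local Set Implicit Arguments.
Local Unset Strict Implicit.
Context {R : realType}.
Implicit Types (lambda x : R).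

Lemma egf_numM (f g : fps R) n :
  egf_num (f * g) n =
  \sum_(k < n.+1) 'C(n, k)%:R * (egf_num f k * egf_num g (n - k)).
Proof.
rewrite /egf_num fps_coefM mulr_sumr; apply: eq_bigr => k _.
have kn : (k <= n)%N by rewrite -ltnS.
by rewrite -(bin_fact kn) !natrM; ring.
Qed.

Lemma dexp_coef0 lambda x : (dexp lambda x) 0%N = 1.
Proof. by rewrite /= /dfall big_ord0 fact0 divr1. Qed.

Lemma dexp_coefS lambda x n :
  n.+1%:R * (dexp lambda x) n.+1 = (x - n%:R * lambda) * (dexp lambda x) n.
Proof.
rewrite /= /dfall big_ord_recr /= factS natrM.
by field; rewrite pnatr_eq0 -lt0n fact_gt0 nat1r pnatr_eq0.
Qed.

Lemma binomial_fpsE x : binomial_fps x = dexp 1 x.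
Proof.
apply/fpsP => n /=; congr (_ / _).
by apply: eq_bigr => i _; rewrite mulr1.
Qed.

Lemma dexp0 lambda : dexp lambda 0 = 1.
Proof.
apply/fpsP => -[|n]; first exact: dexp_coef0.
by rewrite /= /dfall big_ord_recl /= mul0r subrr !mul0r.
Qed.

Lemma coef_dexp_ode lambda (f : fps R) n :
  ((1 + lambda *: fpsX) * fps_deriv f) n =
  n.+1%:R * f n.+1 + n%:R * lambda * f n.
Proof.
rewrite mulrDl mul1r -fps_scalerAl fps_coefD fps_coefZ fps_coefXM.
by case: n => [|n]; rewrite ?mulr0 ?mul0r //=; congr (_ + _); ring.
Qed.

Lemma dexp_ode lambda x :
  (1 + lambda *: fpsX) * fps_deriv (dexp lambda x) = x *: dexp lambda x.
Proof.
apply/fpsP => n; rewrite coef_dexp_ode dexp_coefS fps_coefZ; ring.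
Qed.

(** In coefficients the equation reads (n+1) f_{n+1} = (x - n lambda) f_n, which determines f from
    f_0 because n+1 is invertible. *)
Lemma dexp_ode_unique lambda x (f : fps R) : f 0%N = 1 ->
  (1 + lambda *: fpsX) * fps_deriv f = x *: f -> f = dexp lambda x.
Proof.
move=> f0 /fpsP odef; apply/fpsP; elim=> [|n IH]; first by rewrite dexp_coef0.
apply: (@mulfI _ n.+1%:R); first by rewrite pnatr_eq0.
have := odef n; rewrite coef_dexp_ode fps_coefZ dexp_coefS -IH mulrBl => <-; ring.
Qed.

Lemma dexp_sub1_coef0 lambda x : (dexp lambda x - 1) 0%N = 0.
Proof. by rewrite fps_coefB dexp_coef0 subrr. Qed.

Lemma comp_binomial_dexp lambda x :
  fps_comp (binomial_fps x) (dexp lambda 1 - 1) = dexp lambda x.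
Proof.
have u0 := dexp_sub1_coef0 lambda 1.
set u := dexp lambda 1 - 1 in u0 *.
have uE : 1 + u = dexp lambda 1 by rewrite addrC subrK.
have du : (1 + lambda *: fpsX) * fps_deriv u = 1 + u.
  have := dexp_ode lambda 1.
  by rewrite -uE fps_derivD fps_deriv1 add0r scale1r.
rewrite binomial_fpsE; apply: dexp_ode_unique.
  by rewrite fps_comp_coef0 dexp_coef0.
(* By the chain rule and [du], the left side becomes 1 + u times the derivative of (1 + t)^x taken
   at u. What remains is the equation of (1 + t)^x with u substituted for t. *)
rewrite fps_deriv_comp // mulrCA du mulrC.
have := congr1 (fun f : fps R => fps_comp f u) (dexp_ode 1 x).
by rewrite fps_compM // fps_compD fps_comp1 scale1r fps_compX // fps_compZ.
Qed.

(** Brings the ring inverse in the Changhee generating function within reach of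
    [comp_binomial_dexp]. *)
Lemma binomial_fpsN1 : (1 + fpsX)^-1 = binomial_fps (-1) :> fps R.
Proof.
apply: mulr1_eq; rewrite binomial_fpsE; apply/fpsP => n.
rewrite mulrDl mul1r fps_coefD fps_coefXM fps_coef1.
case: n => [|n]; first by rewrite dexp_coef0 addr0.
apply: (@mulfI _ n.+1%:R); first by rewrite pnatr_eq0.
by rewrite mulrDr dexp_coefS /=; ring.
Qed.

Lemma dstirling2_egf lambda k l : (l <= k)%N ->
  dstirling2 lambda k l =
  egf_num (l`!%:R^-1 *: (dexp lambda 1 - 1) ^+ l) k.
Proof.
rewrite /dstirling2; case: cid => S /= HS.
apply: (dstirling2_unique HS (S' := fun k l =>
  egf_num (l`!%:R^-1 *: (dexp lambda 1 - 1) ^+ l) k)) => {}k x.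
have fact_neq0 : k`!%:R != 0 :> R by rewrite pnatr_eq0 -lt0n fact_gt0.
(* The coefficient of t^k here, times k!, is the defining expansion of [dfall lambda x k] in falling
   factorials. *)
have /fpsP /(_ k) /= := comp_binomial_dexp lambda x.
move/(congr1 ( *%R k`!%:R)); rewrite [RHS]mulrC divfK // => <-.
rewrite mulr_sumr; apply: eq_bigr => i _.
by rewrite /egf_num fps_coefZ; ring.
Qed.

Lemma egf_num_comp (f g : fps R) n :
  egf_num (fps_comp f g) n =
  \sum_(k < n.+1) egf_num f k * egf_num (k`!%:R^-1 *: g ^+ k) n.
Proof.
rewrite /egf_num /= mulr_sumr; apply: eq_bigr => k _; rewrite mulrACA.
by field; rewrite pnatr_eq0 -lt0n fact_gt0.
Qed.

Lemma comp_changhee2_factor lambda :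
  fps_comp (2%:R / ((1 + fpsX) + (1 + fpsX)^-1)) (dexp lambda 1 - 1) =
  2%:R / (dexp lambda 1 + dexp lambda (-1)).
Proof.
have u0 := dexp_sub1_coef0 lambda 1.
rewrite (fps_compM u0) fps_comp_nat (fps_compV u0).
  rewrite binomial_fpsN1 !fps_compD comp_binomial_dexp fps_comp1 (fps_compX u0).
  by rewrite [1 + _]addrC subrK.
(* The denominator is invertible: its constant term is 1 + 1. *)
rewrite binomial_fpsN1 binomial_fpsE !fps_coefD dexp_coef0 fps_coef1 addr0.
by rewrite -(natrD _ 1 1) pnatr_eq0.
Qed.

End DegenerateExponential.

(** * Two expansions of the Changhee generating function at [v] *)

Theorem theorem10 (R : realType) (lambda : R) (r : nat)
    (lambda_neq0 : lambda != 0) (r_gt0 : (0 < r)%N) (n : nat) (x : R) :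
  \sum_(0 <= k < n.+1) jstirling2 lambda n k * changhee2 r x k =
  \sum_(0 <= k < n.+1) 'C(n, k)%:R *
    (\sum_(0 <= l < k.+1)
       deuler2 lambda r 0 l * dstirling2 lambda k l * dbell lambda x (n - k)).
Proof.
have u0 := dexp_sub1_coef0 lambda 1.
pose u := dexp lambda 1 - 1; pose v := fps_comp (dexp lambda 1) u - 1.
pose C := (2%:R / ((1 + fpsX) + (1 + fpsX)^-1)) ^+ r * binomial_fps x.
pose E := (2%:R / (dexp lambda 1 + dexp lambda (-1))) ^+ r * dexp lambda 0.
have compC : fps_comp C v = fps_comp E u * fps_comp (dexp lambda x) u.
  (* Since [v] is [u] composed with itself, substituting [v] amounts to substituting [u] twice; the
     first substitution turns [C] into [E * dexp lambda x]. *)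
  have -> : v = fps_comp u u by rewrite /v {2}/u fps_compD fps_compN fps_comp1.
  rewrite -(fps_compA _ u0 u0) -(fps_compM u0); congr (fps_comp _ u).
  rewrite /C /E dexp0 mulr1 (fps_compM u0) (fps_compXn u0).
  by rewrite comp_changhee2_factor comp_binomial_dexp.
transitivity (egf_num (fps_comp C v) n).
  (* By definition [C] generates the Changhee values and v^k / k! the Jindalrae-Stirling numbers. *)
  rewrite egf_num_comp big_mkord; apply: eq_bigr => k _; exact: mulrC.
rewrite compC egf_numM big_mkord; apply: eq_bigr => k _; congr (_ * _).
(* Here [E] generates the Euler numbers, and u^l / l! the degenerate Stirling numbers, as l <= k. *)
rewrite egf_num_comp mulr_suml big_mkord; apply: eq_bigr => l _.
by rewrite dstirling2_egf -1?ltnS.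
Qed.
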